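(* Let $\mathbb{X}=(X,\mathbb{P})$ be a probabilistic team and $X$ its underlying team. For every formula $\psi\in{\rm FO}(\perp)$, we have that $\mathbb{X} \models \psi$ implies $X\models \psi$. For every $\phi\in{\rm FO}(=\!(\cdot,\cdot))$, we also have the converse, so that $\mathbb{X} \models \phi$ if, and only if, $X\models \phi$.
   Context: A (relational) team is a set $X$ of assignments with a common finite domain of variables; $X(\bar x)$ denotes the set of values of $\bar x$ in $X$. A probabilistic team is a pair $\mathbb{X}=(X,\mathbb{P})$ where $X$ is a relational team (the underlying team, i.e. the support) and $\mathbb{P}\colon X\to(0,1]$ is a probability distribution on $X$. The dependence atom $=\!(\bar x,\bar y)$ holds in a relational team $X$ if any two assignments agreeing on $\bar x$ agree on $\bar y$; in a probabilistic team it holds if for every $\bar a\in X(\bar x)$ there is $\bar b$ with $\mathbb{P}(\bar y=\bar b\mid \bar x=\bar a)=1$. The independence atom $\bar x\perp_{\bar z}\bar y$ holds in a relational team $X$ if for all $s,s'\in X$ with $s(\bar z)=s'(\bar z)$ there is $s''\in X$ with $s''(\bar z)=s(\bar z)$, $s''(\bar x)=s(\bar x)$, $s''(\bar y)=s'(\bar y)$; in a probabilistic team it denotes conditional stochastic independence of $\bar x$ and $\bar y$ given $\bar z$. Dependence logic ${\rm FO}(=\!(\cdot,\cdot))$ is built from first-order literals and dependence atoms, independence logic ${\rm FO}(\perp)$ from first-order literals and independence atoms, using $\land,\lor,\exists,\forall$ (negation only on first-order atoms); ${\rm FO}(=\!(\cdot,\cdot))\subseteq{\rm FO}(\perp)$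 since $=\!(\bar x,\bar y)\equiv \bar y\perp_{\bar x}\bar y$. Relational team semantics: $\land$ componentwise; $X\models\phi_1\lor\phi_2$ if $X=X_1\cup X_2$ with $X_i\models\phi_i$; $\forall x$ via the full extension $X[x\mapsto A]$; $\exists x$ via some Skolem extension $X[x\mapsto F]$ with $F\colon X\to\mathcal P(A)\setminus\{\emptyset\}$. Probabilistic team semantics: first-order literals hold iff they hold in the underlying team; $\lor$ via a split of $\mathbb{X}$ into a convex combination $(1-\lambda)\mathbb{P}_{\mathbb{X}_1}+\lambda\mathbb{P}_{\mathbb{X}_2}$ with $X=X_1\cup X_2$ and $\mathbb{X}_i\models\phi_i$; $\forall x$ via the uniform extension; $\exists x$ via a Skolem extension by a function mapping each assignment to a probability distribution over the universe $A$ (splitting its probability mass). *)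

(* Defs.v *)
From HB Require Import structures.
From mathcomp Require Import all_boot all_order all_algebra finmap.
From mathcomp Require Import reals.

Set Implicit Arguments.
Unset Strict Implicit.
Unset Printing Implicit Defensive.

Import Order.TTheory GRing.Theory Num.Theory.
Local Open Scope ring_scope.

Record signature := Signature {
  rel_sym : Type;
  rel_ar : rel_sym -> nat;
  fun_sym : Type;
  fun_ar : fun_sym -> nat }.

(* Universes are finite: the uniform extension interpreting the universal
   quantifier on probabilistic teams requires it. *)
Record structure (tau : signature) := Structure {
  univ :> finType;
  univ_gt0 : (0 < #|univ|)%N;
  rel_int : forall r : rel_sym tau, {ffun 'I_(rel_ar r) -> univ} -> bool;
  fun_int : forall f : fun_sym tau, {ffun 'I_(fun_ar f) -> univ} -> univ }.

(* Variables are natural numbers.  Terms and formulas are indexed by a finite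
   set D of variables: [team_formula tau D] is the type of formulas whose free
   variables belong to D.  Quantifying a variable that is already in D is
   allowed (x |` D is then D, and the old value of x is overwritten). *)
Inductive term (tau : signature) (D : {fset nat}) :=
| Var of D
| App (f : fun_sym tau) of ('I_(fun_ar f) -> term tau D).
Arguments Var {tau D}.
Arguments App {tau D}.

Inductive fo_atom (tau : signature) (D : {fset nat}) :=
| EqAtom of term tau D & term tau D
| RelAtom (r : rel_sym tau) of ('I_(rel_ar r) -> term tau D).
Arguments EqAtom {tau D}.
Arguments RelAtom {tau D}.

(* [Dep xs ys] is =(xs, ys); [Indep xs zs ys] is xs _||_{zs} ys. *)
Inductive team_formula (tau : signature) (D : {fset nat}) :=
| PosLit of fo_atom tau D
| NegLit of fo_atom tau D
| Dep of seq D & seq D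
| Indep of seq D & seq D & seq D
| And of team_formula tau D & team_formula tau D
| Or of team_formula tau D & team_formula tau D
| Ex (x : nat) of team_formula tau (x |` D)%fset
| All (x : nat) of team_formula tau (x |` D)%fset.
Arguments PosLit {tau D}.
Arguments NegLit {tau D}.
Arguments Dep {tau D}.
Arguments Indep {tau D}.
Arguments And {tau D}.
Arguments Or {tau D}.
Arguments Ex {tau D}.
Arguments All {tau D}.

Fixpoint dependence_logic (tau : signature) (D : {fset nat})
    (phi : team_formula tau D) : bool :=
  match phi with
  | PosLit _ | NegLit _ | Dep _ _ => true
  | Indep _ _ _ => false
  | And p q | Or p q => dependence_logic p && dependence_logic q
  | Ex _ p | All _ p => dependence_logic p
  end.

Fixpoint independence_logic (tau : signature) (D : {fset nat})
    (phi : team_formula tau D) : bool :=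
  match phi with
  | PosLit _ | NegLit _ | Indep _ _ _ => true
  | Dep _ _ => false
  | And p q | Or p q => independence_logic p && independence_logic q
  | Ex _ p | All _ p => independence_logic p
  end.

Definition assignment (A : finType) (D : {fset nat}) := {ffun D -> A}.

Definition team (A : finType) (D : {fset nat}) := {set assignment A D}.

(* The assignment s[x |-> a].  The last branch is never reached. *)
Definition upd (A : finType) (D : {fset nat}) (s : assignment A D)
    (x : nat) (a : A) : assignment A (x |` D)%fset :=
  [ffun y : (x |` D)%fset =>
     if val y == x then a
     else if insub (val y) : option D is Some z then s z else a].

Definition vals (A : finType) (D : {fset nat}) (s : assignment A D)
    (xs : seq D) : seq A := [seq s x | x <- xs].

(* The set X(xs) of values of xs in X. *)
Definition in_values (A : finType) (D : {fset nat}) (X : team A D)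
    (xs : seq D) (a : seq A) : Prop :=
  exists2 s, s \in X & vals s xs = a.

Fixpoint term_val (tau : signature) (A : structure tau) (D : {fset nat})
    (s : assignment A D) (t : term tau D) : A :=
  match t with
  | Var x => s x
  | App f ts => fun_int [ffun i => term_val s (ts i)]
  end.

Definition atom_holds (tau : signature) (A : structure tau) (D : {fset nat})
    (s : assignment A D) (at_ : fo_atom tau D) : bool :=
  match at_ with
  | EqAtom t u => term_val s t == term_val s u
  | RelAtom r ts => rel_int [ffun i => term_val s (ts i)]
  end.

Definition skolem_ext (A : finType) (D : {fset nat}) (X : team A D)
    (x : nat) (F : assignment A D -> {set A}) : team A (x |` D)%fset :=
  [set upd s x a | s in X, a in F s].

Definition full_ext (A : finType) (D : {fset nat}) (X : team A D)
    (x : nat) : team A (x |` D)%fset :=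
  [set upd s x a | s in X, a in [set: A]].

Fixpoint rsat (tau : signature) (A : structure tau) (D : {fset nat})
    (phi : team_formula tau D) {struct phi} : team A D -> Prop :=
  match phi in team_formula _ _ return team A _ -> Prop with
  | PosLit at_ => fun X => forall s, s \in X -> atom_holds s at_
  | NegLit at_ => fun X => forall s, s \in X -> ~~ atom_holds s at_
  | Dep xs ys => fun X => forall s s', s \in X -> s' \in X ->
      vals s xs = vals s' xs -> vals s ys = vals s' ys
  | Indep xs zs ys => fun X => forall s s', s \in X -> s' \in X ->
      vals s zs = vals s' zs ->
      exists s'', [/\ s'' \in X, vals s'' zs = vals s zs,
                      vals s'' xs = vals s xs & vals s'' ys = vals s' ys]
  | And p q => fun X => rsat p X /\ rsat q X
  | Or p q => fun X =>
      exists X1 X2, [/\ X = X1 :|: X2, rsat p X1 & rsat q X2]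
  | Ex x p => fun X =>
      exists2 F : assignment A _ -> {set A},
        (forall s, s \in X -> F s != set0) & rsat p (skolem_ext X x F)
  | All x p => fun X => rsat p (full_ext X x)
  end.

Record distribution (R : realType) (A : finType) := Distribution {
  dmass :> A -> R;
  dmass_ge0 : forall a, 0 <= dmass a;
  dmass_sum : \sum_a dmass a = 1 }.

(* The distribution P : X -> (0, 1] is represented by its extension by 0 to
   all assignments.  The bound pr s <= 1 follows from the other fields. *)
Record pteam (R : realType) (A : finType) (D : {fset nat}) := PTeam {
  uteam : team A D;
  pr : assignment A D -> R;
  pr_gt0 : forall s, s \in uteam -> 0 < pr s;
  pr_out : forall s, s \notin uteam -> pr s = 0;
  pr_sum : \sum_(s in uteam) pr s = 1 }.

Definition prob (R : realType) (A : finType) (D : {fset nat})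
    (X : pteam R A D) (E : pred (assignment A D)) : R :=
  \sum_(s in uteam X | E s) pr X s.

Definition cprob (R : realType) (A : finType) (D : {fset nat})
    (X : pteam R A D) (E C : pred (assignment A D)) : R :=
  prob X (predI E C) / prob X C.

Definition has_vals (A : finType) (D : {fset nat}) (xs : seq D)
    (a : seq A) : pred (assignment A D) := fun s => vals s xs == a.

(* Several pairs (s, a) may yield the same s[x |-> a] when x is already in D;
   their masses add up. *)
Definition pskolem_pr (R : realType) (A : finType) (D : {fset nat})
    (X : pteam R A D) (x : nat) (F : assignment A D -> distribution R A)
    (t : assignment A (x |` D)%fset) : R :=
  \sum_(s in uteam X) \sum_(a | upd s x a == t) pr X s * F s a.
Arguments pskolem_pr {R A D} X x F t.

Definition dsupp (R : realType) (A : finType) (m : distribution R A) : {set A} :=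
  [set a | 0 < m a].

Definition pskolem_team (R : realType) (A : finType) (D : {fset nat})
    (X : pteam R A D) (x : nat) (F : assignment A D -> distribution R A) :
    team A (x |` D)%fset :=
  skolem_ext (uteam X) x (fun s => dsupp (F s)).

Lemma pskolem_gt0 (R : realType) (A : finType) (D : {fset nat})
    (X : pteam R A D) (x : nat) (F : assignment A D -> distribution R A) t :
  t \in pskolem_team X x F -> 0 < pskolem_pr X x F t.
Proof.
case/imset2P=> s a sX; rewrite inE => Fa ->.
have ge0 s' a' : s' \in uteam X -> 0 <= pr X s' * F s' a'.
  by move=> s'X; rewrite mulr_ge0 ?dmass_ge0 // ltW // pr_gt0.
rewrite /pskolem_pr (bigD1 s) //= ltr_pwDl //.
  rewrite (bigD1 a) //= ltr_pwDl ?mulr_gt0 ?pr_gt0 //.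
  by apply: sumr_ge0 => *; apply: ge0.
by apply: sumr_ge0 => s' /andP[s'X _]; apply: sumr_ge0 => *; apply: ge0.
Qed.

Lemma pskolem_out (R : realType) (A : finType) (D : {fset nat})
    (X : pteam R A D) (x : nat) (F : assignment A D -> distribution R A) t :
  t \notin pskolem_team X x F -> pskolem_pr X x F t = 0.
Proof.
move=> tN; rewrite /pskolem_pr big1 // => s sX; rewrite big1 // => a /eqP at_.
have [Fa|/negbTE Fa] := boolP (0 < F s a).
  by case/negP: tN; apply/imset2P; exists s a; rewrite ?inE.
suff -> : F s a = 0 by rewrite mulr0.
by apply/eqP; have := dmass_ge0 (F s) a; rewrite le_eqVlt Fa orbF eq_sym.
Qed.

Lemma pskolem_sum (R : realType) (A : finType) (D : {fset nat})
    (X : pteam R A D) (x : nat) (F : assignment A D -> distribution R A) :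
  \sum_(t in pskolem_team X x F) pskolem_pr X x F t = 1.
Proof.
transitivity (\sum_t pskolem_pr X x F t).
  rewrite [RHS](bigID (mem (pskolem_team X x F))) /= [X in _ = _ + X]big1 ?addr0//.
  by move=> t; apply: pskolem_out.
rewrite /pskolem_pr exchange_big /= -(pr_sum X); apply: eq_bigr => s sX.
rewrite (exchange_big_dep xpredT) //=.
transitivity (\sum_a pr X s * F s a).
  by apply: eq_bigr => a _; rewrite (big_pred1 (upd s x a)) // => t; rewrite eq_sym.
by rewrite -mulr_sumr dmass_sum mulr1.
Qed.

Definition pskolem_ext (R : realType) (A : finType) (D : {fset nat})
    (X : pteam R A D) (x : nat) (F : assignment A D -> distribution R A) :
    pteam R A (x |` D)%fset :=
  PTeam (@pskolem_gt0 R A D X x F) (@pskolem_out R A D X x F)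
        (pskolem_sum X x F).

Lemma uniform_ge0 (R : realType) (A : finType) (a : A) :
  0 <= (#|A|%:R)^-1 :> R.
Proof. by rewrite invr_ge0 ler0n. Qed.

Lemma uniform_sum (R : realType) (A : finType) (A0 : (0 < #|A|)%N) :
  \sum_(a : A) (#|A|%:R)^-1 = 1 :> R.
Proof.
by rewrite sumr_const -[_ *+ _]mulr_natl divff // pnatr_eq0 -lt0n.
Qed.

Definition uniform (R : realType) (A : finType) (A0 : (0 < #|A|)%N) :
    distribution R A :=
  Distribution (@uniform_ge0 R A) (uniform_sum R A0).

Definition uniform_ext (R : realType) (tau : signature) (A : structure tau)
    (D : {fset nat}) (X : pteam R A D) (x : nat) : pteam R A (x |` D)%fset :=
  pskolem_ext X x (fun=> uniform R (univ_gt0 A)).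

Definition psplit (R : realType) (A : finType) (D : {fset nat})
    (X X1 X2 : pteam R A D) : Prop :=
  uteam X = uteam X1 :|: uteam X2 /\
  exists2 lam : R, 0 <= lam <= 1 &
    forall s, pr X s = (1 - lam) * pr X1 s + lam * pr X2 s.

(* In the clause for Or, the first two disjuncts are the splits with an empty
   part: the empty team, which satisfies every formula, carries no probability
   distribution and hence is not a pteam. *)
Fixpoint psat (R : realType) (tau : signature) (A : structure tau)
    (D : {fset nat}) (phi : team_formula tau D) {struct phi} : pteam R A D -> Prop :=
  match phi in team_formula _ _ return pteam R A _ -> Prop with
  | PosLit at_ => fun X => forall s, s \in uteam X -> atom_holds s at_
  | NegLit at_ => fun X => forall s, s \in uteam X -> ~~ atom_holds s at_
  | Dep xs ys => fun X => forall a, in_values (uteam X) xs a ->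
      exists b, cprob X (has_vals ys b) (has_vals xs a) = 1
  | Indep xs zs ys => fun X => forall a b c, in_values (uteam X) zs c ->
      cprob X (predI (has_vals xs a) (has_vals ys b)) (has_vals zs c) =
      cprob X (has_vals xs a) (has_vals zs c) *
      cprob X (has_vals ys b) (has_vals zs c)
  | And p q => fun X => psat p X /\ psat q X
  | Or p q => fun X =>
      [\/ psat p X, psat q X |
          exists X1 X2, [/\ psplit X X1 X2, psat p X1 & psat q X2]]
  | Ex x p => fun X =>
      exists F : assignment A _ -> distribution R A,
        psat p (pskolem_ext X x F)
  | All x p => fun X => psat p (uniform_ext X x)
  end.

(* Main.v *)
(* Both implications go by induction on the formula, between a probabilistic
   team and its support.  From probabilistic to relational, every clause passes
   to supports: an event has positive probability exactly when the support
   meets it.  Conversely, dependence atoms only speak about supports, so it is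
   enough to realise relational witnesses as supports: a Skolem function becomes
   the uniform distribution on each of its values, and in a split X = X1 u X2
   the mass of an assignment lying in both parts is shared equally. *)
Require Import Defs.
From mathcomp Require Import all_boot all_order all_algebra finmap.
From mathcomp Require Import reals.

Set Implicit Arguments.
Unset Strict Implicit.
Unset Printing Implicit Defensive.

Import Order.TTheory GRing.Theory Num.Theory.
Local Open Scope ring_scope.

Section Probability.
Variables (R : realType) (A : finType) (D : {fset nat}) (X : pteam R A D).
Implicit Types E C : pred (assignment A D).

Lemma prob_gt0P E :
  reflect (exists2 s, s \in uteam X & E s) (0 < prob X E).
Proof.
apply: (iffP idP) => [|[s sX Es]].
  have [s /andP[sX Es] _|E0] := pickP [pred s | (s \in uteam X) && E s].
    by exists s.
  by rewrite /prob big_pred0 ?ltxx.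
rewrite /prob (bigD1 s) /= ?sX // ltr_pwDl ?pr_gt0 //.
by apply: sumr_ge0 => t /andP[/andP[tX _] _]; rewrite ltW ?pr_gt0.
Qed.

Lemma probID E C : prob X C = prob X (predI E C) + prob X (predI (predC E) C).
Proof.
rewrite /prob (bigID E) /=; congr (_ + _); apply: eq_bigl => s /=;
  by rewrite -andbA (andbC (C s)).
Qed.

(** Links the two forms of the dependence atom: a member of the support in [C] outside [E] would
    carry positive mass. The premise keeps the denominator [prob X C] nonzero. *)
Lemma cprob_eq1P E C : (exists2 s, s \in uteam X & C s) ->
  cprob X E C = 1 <-> (forall s, s \in uteam X -> C s -> E s).
Proof.
move=> /prob_gt0P C0; have C1 : prob X C != 0 by rewrite gt_eqF.
split=> [EC s sX Cs|EC].
  (* By additivity the part of [C] outside [E] would have mass zero, yet [s] lies in it. *)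
  apply/negPn/negP => nEs; have : prob X (predI E C) = prob X C.
    by rewrite -[LHS](divfK C1) -/(cprob X E C) EC mul1r.
  rewrite (probID E C) => /eqP; rewrite addrC -subr_eq subrr eq_sym => /eqP nEC0.
  have : 0 < prob X (predI (predC E) C).
    by apply/prob_gt0P; exists s => //=; rewrite nEs Cs.
  by rewrite nEC0 ltxx.
rewrite /cprob (_ : prob X (predI E C) = prob X C) ?divff //.
apply: eq_bigl => s /=; case: (boolP (s \in uteam X)) => //= sX.
by case: (boolP (C s)) => [/(EC s sX) ->|]; rewrite ?andbF.
Qed.

Lemma cprob_gt0P E C : (exists2 s, s \in uteam X & C s) ->
  reflect (exists2 s, s \in uteam X & E s && C s) (0 < cprob X E C).
Proof.
by move=> /prob_gt0P C0; rewrite /cprob pmulr_lgt0 ?invr_gt0 //; apply: prob_gt0P.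
Qed.

End Probability.

Section Distributions.
Variables (R : realType) (A : finType).

(** Makes the supports of Skolem distributions admissible values of a relational Skolem function. *)
Lemma dsupp_neq0 (m : distribution R A) : dsupp m != set0.
Proof.
apply/eqP => m0; have := dmass_sum m; rewrite big1 => [/eqP|a _].
  by rewrite eq_sym oner_eq0.
have := in_set0 a; rewrite -m0 inE => /negbT; rewrite -leNgt => ma.
by apply/eqP; rewrite eq_le ma dmass_ge0.
Qed.

Variables (B : {set A}) (B0 : B != set0).

Definition uniform_on_mass (a : A) : R := (a \in B)%:R / #|B|%:R.

Lemma uniform_on_ge0 a : 0 <= uniform_on_mass a.
Proof. by rewrite mulr_ge0 ?invr_ge0 ?ler0n. Qed.

Lemma uniform_on_sum : \sum_a uniform_on_mass a = 1.
Proof.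
rewrite -mulr_suml -natr_sum -big_mkcond sum1_card divff //.
by rewrite pnatr_eq0 cards_eq0.
Qed.

Definition uniform_on : distribution R A :=
  Distribution uniform_on_ge0 uniform_on_sum.

Lemma dsupp_uniform_on : dsupp uniform_on = B.
Proof.
apply/setP => a; rewrite inE /= /uniform_on_mass.
case: (a \in B); last by rewrite mul0r ltxx.
by rewrite mul1r invr_gt0 ltr0n card_gt0.
Qed.

End Distributions.

Lemma dsupp_uniform (R : realType) (A : finType) (A0 : (0 < #|A|)%N) :
  dsupp (uniform R A0) = [set: A].
Proof. by apply/setP => a; rewrite !inE /= invr_gt0 ltr0n. Qed.

Lemma uteam_uniform_ext (R : realType) (tau : signature) (A : structure tau)
    (D : {fset nat}) (X : pteam R A D) x :
  uteam (uniform_ext X x) = full_ext (uteam X) x.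
Proof. by rewrite /= /pskolem_team dsupp_uniform. Qed.

Lemma eq_skolem_ext (A : finType) (D : {fset nat}) (X : team A D) x
    (F G : assignment A D -> {set A}) :
  {in X, F =1 G} -> skolem_ext X x F = skolem_ext X x G.
Proof.
move=> FG; apply/setP => t.
by apply/imset2P/imset2P => -[s a sX Fa ->]; exists s a; rewrite // ?FG // -FG.
Qed.

Lemma skolem_realize (R : realType) (A : finType) (A0 : (0 < #|A|)%N)
    (D : {fset nat}) (X : pteam R A D) x (F : assignment A D -> {set A}) :
  (forall s, s \in uteam X -> F s != set0) ->
  exists G : assignment A D -> distribution R A,
    uteam (pskolem_ext X x G) = skolem_ext (uteam X) x F.
Proof.
(* [uniform_on] takes a proof of nonemptiness, hence the match on [idP]. Outside the team [F s] may
   be empty; the default value there does not affect the extension. *)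
move=> F0; exists (fun s => if @idP (F s != set0) is ReflectT Fs0
                            then uniform_on R Fs0 else uniform R A0).
apply: eq_skolem_ext => s sX; case: {-}_ / idP => [Fs0|/(_ (F0 s sX))] //.
exact: dsupp_uniform_on.
Qed.

Section Splits.
Variables (R : realType) (A : finType) (D : {fset nat}).

(** Turns one part's share of the mass into a probabilistic team; the total weight is kept explicit
    because it becomes a coefficient of the convex combination. *)
Lemma normalize_weight (Y : team A D) (w : assignment A D -> R) :
  Y != set0 -> (forall s, s \in Y -> 0 < w s) ->
  (forall s, s \notin Y -> w s = 0) ->
  exists2 X : pteam R A D, uteam X = Y & forall s, w s = (\sum_t w t) * pr X s.
Proof.
move=> /set0Pn[s0 s0Y] wY wN.
have sumE : \sum_t w t = \sum_(t in Y) w t.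
  rewrite (bigID (mem Y)) /= [X in _ + X]big1 ?addr0 // => t; exact: wN.
have w0 : 0 < \sum_t w t.
  rewrite sumE (bigD1 s0) //= ltr_pwDl ?wY //.
  by apply: sumr_ge0 => t /andP[tY _]; rewrite ltW ?wY.
pose p s := w s / \sum_t w t.
have pY s : s \in Y -> 0 < p s by move=> sY; rewrite divr_gt0 ?wY.
have pN s : s \notin Y -> p s = 0 by move=> sN; rewrite /p wN ?mul0r.
have pS : \sum_(s in Y) p s = 1 by rewrite -mulr_suml -sumE divff ?gt_eqF.
by exists (PTeam pY pN pS) => // s; rewrite /= mulrC divfK ?gt_eqF.
Qed.

Lemma pr_total (X : pteam R A D) : \sum_s pr X s = 1.
Proof.
rewrite (bigID (mem (uteam X))) /= pr_sum big1 ?addr0 // => s.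
exact: pr_out.
Qed.

Lemma psplit_realize (X : pteam R A D) (Y1 Y2 : team A D) :
  uteam X = Y1 :|: Y2 -> Y1 != set0 -> Y2 != set0 ->
  exists X1 X2 : pteam R A D,
    [/\ psplit X X1 X2, uteam X1 = Y1 & uteam X2 = Y2].
Proof.
move=> XE Y10 Y20.
(* The share of [Y] in the mass of [X], where [Y'] is the other part. Halving on the overlap keeps
   both shares positive there. *)
pose half (Y Y' : team A D) s : R :=
  if s \in Y then if s \in Y' then pr X s / 2 else pr X s else 0.
have halfP Y Y' : Y :|: Y' = uteam X -> forall s, s \in Y -> 0 < half Y Y' s.
  move=> YE s sY; have sX : 0 < pr X s by rewrite pr_gt0 // -YE inE sY.
  by rewrite /half sY; case: ifP; rewrite ?divr_gt0.
have halfN (Y Y' : team A D) s : s \notin Y -> half Y Y' s = 0.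
  by rewrite /half => /negbTE ->.
have [X1 X1E w1] := normalize_weight Y10 (halfP Y1 Y2 (esym XE)) (halfN Y1 Y2).
have [|X2 X2E w2] := normalize_weight Y20 (halfP Y2 Y1 _) (halfN Y2 Y1).
  by rewrite setUC.
have prE s : pr X s = half Y1 Y2 s + half Y2 Y1 s.
  rewrite /half; have := @pr_out _ _ _ X s; rewrite XE inE.
  case: (s \in Y1); case: (s \in Y2) => /= out; rewrite ?addr0 ?add0r //.
    by rewrite -splitr.
  exact: out.
have sum1 : \sum_s half Y1 Y2 s + \sum_s half Y2 Y1 s = 1.
  by rewrite -[RHS](pr_total X) (eq_bigr _ (fun s _ => prE s)) big_split.
have ge0 Y Y' : 0 <= \sum_s half Y Y' s.
  apply: sumr_ge0 => s _; rewrite /half.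
  have : 0 <= pr X s.
    by case: (boolP (s \in uteam X)) => [/pr_gt0/ltW|/pr_out ->].
  by case: ifP => // _ ?; case: ifP => // _; rewrite divr_ge0.
exists X1, X2; split=> //; split; first by rewrite XE X1E X2E.
(* The coefficient is the total mass of the second share, so [1 - lam] is that of the first, and
   both normalisations cancel. *)
exists (\sum_s half Y2 Y1 s); first by rewrite ge0 -sum1 lerDr ge0.
by move=> s; rewrite -{1}sum1 addrK -w1 -w2.
Qed.

End Splits.

(** Supplies the empty part of a relational split when a whole probabilistic team satisfies a single
    disjunct. Atoms hold vacuously, and every extension of the empty team is empty. *)
Lemma rsat_set0 (tau : signature) (A : structure tau) (D : {fset nat})
    (phi : team_formula tau D) : rsat phi (set0 : team A D).
Proof.
have ext0 E x (F : assignment A E -> {set A}) : skolem_ext set0 x F = set0.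
  by apply/setP => t; rewrite inE; apply/imset2P => -[s a]; rewrite inE.
elim: phi => {D} [D a|D a|D xs ys|D xs zs ys|D p IHp q IHq|D p IHp q IHq
                 |D x p IHp|D x p IHp] /=.
- by move=> s; rewrite inE.
- by move=> s; rewrite inE.
- by move=> s s'; rewrite inE.
- by move=> s s'; rewrite inE.
- by [].
- by exists set0, set0; rewrite setU0.
- by exists (fun=> set0) => [s|]; rewrite ?inE ?ext0.
- by rewrite -[full_ext _ _]/(skolem_ext set0 x (fun=> setT)) ext0.
Qed.

Lemma psat_rsat (R : realType) (tau : signature) (A : structure tau)
    (D : {fset nat}) (phi : team_formula tau D) (X : pteam R A D) :
  psat phi X -> rsat phi (uteam X).
Proof.
elim: phi X => {D} [D a|D a|D xs ys|D xs zs ys|D p IHp q IHq|D p IHp q IHq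
                   |D x p IHp|D x p IHp] X //=.
- move=> dep s s' sX s'X ss'; have sa : has_vals xs (vals s xs) s by apply/eqP.
  (* Both [s] and [s'] must take the almost sure value [b] on [ys]. *)
  have [|b /cprob_eq1P] := dep (vals s xs); first by exists s.
  move=> /(_ (ex_intro2 _ _ s sX sa)) xy.
  have /eqP -> := xy s sX sa; symmetry; apply/eqP/xy => //.
  by rewrite /has_vals ss'.
- move=> ind s s' sX s'X ss'; set c := vals s zs.
  have sc : has_vals zs c s by apply/eqP.
  have s'c : has_vals zs c s' by apply/eqP.
  have C : exists2 s, s \in uteam X & has_vals zs c s by exists s.
  (* Given [c], the marginals are positive, witnessed by [s] and [s']. Independence makes the joint
     probability their product, so the support meets the joint event, at the required assignment. *)
  have /(cprob_gt0P _ C)[] : 0 < cprob X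
      (predI (has_vals xs (vals s xs)) (has_vals ys (vals s' ys)))
      (has_vals zs c).
    rewrite ind; last by exists s.
    rewrite mulr_gt0 //; apply/(cprob_gt0P _ C).
      by exists s => //; rewrite sc andbT /has_vals.
    by exists s' => //; rewrite s'c andbT /has_vals.
  by move=> t tX /= /andP[/andP[/eqP tx /eqP ty] /eqP tz]; exists t.
- by move=> [/IHp ? /IHq ?].
- case=> [/IHp Xp|/IHq Xq|[X1 [X2 [[XE _] /IHp X1p /IHq X2q]]]].
  + by exists (uteam X), set0; rewrite setU0; split=> //; apply: rsat_set0.
  + by exists set0, (uteam X); rewrite set0U; split=> //; apply: rsat_set0.
  + by exists (uteam X1), (uteam X2).
- by move=> [F /IHp XF]; exists (fun s => dsupp (F s)) => // s _; apply: dsupp_neq0.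
- by move=> /IHp; rewrite uteam_uniform_ext.
Qed.

(** The induction hypothesis covers all probabilistic teams, so only the support of a chosen witness
    matters. [dependence_logic] excludes independence atoms, whose probabilistic truth depends on
    the masses. *)
Lemma rsat_psat (R : realType) (tau : signature) (A : structure tau)
    (D : {fset nat}) (phi : team_formula tau D) (X : pteam R A D) :
  dependence_logic phi -> rsat phi (uteam X) -> psat phi X.
Proof.
elim: phi X => {D} [D a|D a|D xs ys|D xs zs ys|D p IHp q IHq|D p IHp q IHq
                   |D x p IHp|D x p IHp] X //=.
- move=> _ dep a [s sX sa]; exists (vals s ys); apply/cprob_eq1P.
    by exists s => //; apply/eqP.
  by move=> t tX /eqP ta; apply/eqP/dep => //; rewrite ta.
- by move=> /andP[dp dq] [/(IHp X dp) ? /(IHq X dq) ?].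
- move=> /andP[dp dq] [Y1 [Y2 [XE Y1p Y2q]]].
  (* An empty part cannot be the support of a [pteam]; the other part is then all of [X]. *)
  have [Y10|Y10] := eqVneq Y1 set0.
    by apply: Or32; apply: IHq; rewrite // XE Y10 set0U.
  have [Y20|Y20] := eqVneq Y2 set0.
    by apply: Or31; apply: IHp; rewrite // XE Y20 setU0.
  have [X1 [X2 [X12 X1E X2E]]] := psplit_realize XE Y10 Y20.
  by apply: Or33; exists X1, X2; split; rewrite //; [apply: IHp|apply: IHq];
    rewrite ?X1E ?X2E.
- move=> dp [F F0 XFp]; have [G GE] := skolem_realize (univ_gt0 A) x F0.
  by exists G; apply: IHp; rewrite // GE.
- by move=> dp Xp; apply: IHp; rewrite // uteam_uniform_ext.
Qed.

Theorem theorem3p5 (R : realType) (tau : signature) (A : structure tau)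
    (D : {fset nat}) (XX : pteam R A D) :
  (forall psi : team_formula tau D, independence_logic psi ->
     psat psi XX -> rsat psi (uteam XX)) /\
  (forall phi : team_formula tau D, dependence_logic phi ->
     (psat phi XX <-> rsat phi (uteam XX))).
Proof.
split=> [psi _|phi dphi]; first exact: psat_rsat.
by split; [apply: psat_rsat|apply: rsat_psat].
Qed.
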